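(* Let $\Delta, k, n \in \mathbb{N}$ with $k \ge (\Delta+2)/2$ and $n \ge 3\Delta^4$. Then every $n$-vertex graph with maximum degree at most $\Delta$ has an equitable tree $k$-colouring.
   Context: $\mathbb{N}$ is the set of positive integers. Graphs are finite and simple. A $k$-colouring of a graph $G$ is a map $\varphi: V(G)\to\{1,\dots,k\}$ (not required to be proper); its colour classes are the sets $\varphi^{-1}(i)$, $i\in\{1,\dots,k\}$ (possibly empty). It is equitable if the sizes of any two colour classes differ by at most one. It is a tree $k$-colouring if the subgraph of $G$ induced on each colour class is a forest (i.e. acyclic). An equitable tree $k$-colouring is a $k$-colouring that is both equitable and a tree $k$-colouring. *)

(* Defs.v *)
From mathcomp Require Import all_boot.

Set Implicit Arguments.
Unset Strict Implicit.
Unset Printing Implicit Defensive.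

(* A finite simple graph is a symmetric irreflexive relation e on a finType. *)

Definition degree (T : finType) (e : rel T) (x : T) : nat :=
  #|[set y | e x y]|.

Definition max_degree (T : finType) (e : rel T) : nat :=
  \max_(x : T) degree e x.

Definition induced (T : finType) (e : rel T) (A : {set T}) :
  rel {x : T | x \in A} := relpre val e.
Arguments induced {T} e A.

(* ucycle holds of the empty sequence, of [:: x] when e x x, and of [:: x; y]
   for an edge xy of a symmetric e; the graph cycles are the duplicate-free
   cyclic sequences with at least 3 vertices. *)
Definition is_forest (T : finType) (e : rel T) : Prop :=
  forall p : seq T, 2 < size p -> ~ ucycle e p.

Definition colour_class (T : finType) (k : nat) (phi : {ffun T -> 'I_k})
  (i : 'I_k) : {set T} := [set x | phi x == i].

Definition equitable (T : finType) (k : nat) (phi : {ffun T -> 'I_k}) : Prop :=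
  forall i j : 'I_k, #|colour_class phi i| <= #|colour_class phi j| + 1.

Definition tree_colouring (T : finType) (e : rel T) (k : nat)
  (phi : {ffun T -> 'I_k}) : Prop :=
  forall i : 'I_k, is_forest (induced e (colour_class phi i)).

Definition equitable_tree_colouring (T : finType) (e : rel T) (k : nat)
  (phi : {ffun T -> 'I_k}) : Prop :=
  equitable phi /\ tree_colouring e phi.

(* Main.v *)
Require Import Defs.
From mathcomp Require Import all_boot.
From mathcomp Require Import zify.

(** Write [k] for the number of colours and prescribe for every colour [i] a
    capacity [c i], equal to [n %/ k] or to that plus one, with total [n]; a
    colouring whose classes are forests within their capacities is what is
    sought.  All moves send a vertex into a class where it has at most one
    neighbour: it becomes a leaf there, so forests stay forests.

    Insert the vertices one at a time.  If the new vertex may enter a class from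
    which moves lead from class to class to one with room, the surplus is passed
    along them ([shift]).  Otherwise the set [A] of classes from which a class
    with room can be reached is closed: each vertex outside their union [U] has
    at least two neighbours in each class of [A]
    ([config], [augment_or_config]).  Such a vertex has at most
    [2 * (k - #|A|) - 2] neighbours outside [U], and there is exactly one
    vertex too many there.  Hence it suffices to squeeze one more vertex [w] into
    the classes of [A]: the vertices still outside are then coloured with
    the other colours by induction on the number of colours
    ([extend_by_smaller]).

    Take [A] as small as possible.  Count the edges between one class of [A] and
    the outside.  Call a vertex of [U] dense if it has at least [2 * #|A| - 1]
    neighbours in [U]; then it has at most [2 * (k - #|A|) - 1] outside, one less
    than twice the number of the other colours.  Because classes are large,
    this gives an outside vertex [w] with at most one dense neighbour in a
    chosen class [W] ([good_vertex]).  Its other neighbours in [W] are moved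
    out of [W] one by one until [w] closes no cycle there.  This is possible:
    such a neighbour [x] has at most [2 * #|A| - 2] neighbours in [U], and if it
    lies on a cycle of [W] with [w], then one of these is in [W], so some other
    class [X] of [A] has at most one.  When [x] goes to [X], a vertex of [X] is
    passed on, towards a class with room or back to [W], with [w] already
    counted as a vertex of [W], so that what arrives in [W] lies on no cycle
    through [w] ([swap_out]).

    If [X] cannot pass a vertex on in this way, the classes that can do so form a
    proper subset [B] of [A], and the only vertices outside that could move into
    a class of [B] are neighbours of [w] moving into [W].  By minimality of [A]
    one of them does, so one vertex is squeezed into [B], and the rest is
    coloured by induction.  The price is that the neighbours of [w] may there
    exceed the degree bound by one ([solved_if_blocked]).  The induction
    therefore carries a set [F] of exceptional vertices whose degree bound is
    one larger.  It grows by at most the maximum degree at each step, and as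
    [w] is chosen without neighbours in [F] no vertex becomes exceptional
    twice.  The counting tolerates such an [F] if the classes have about
    [2 * Delta ^ 3] vertices, which [3 * Delta ^ 4 <= n] ensures when
    [k <= Delta].  For [k > Delta] the edge count alone excludes a closed set
    [A] ([fits_many_colours]). *)

Set Implicit Arguments.
Unset Strict Implicit.
Unset Printing Implicit Defensive.

(** * Forests and leaves *)

Section Graph.

Variables (T : finType) (e : rel T).

Definition nbrs (v : T) (X : {set T}) : nat := #|[set y in X | e v y]|.

(** Forests are described by cycles of the ambient graph, without passing to
    induced subgraphs, so that vertex sets can be compared freely. *)
Definition forest (X : {set T}) : Prop :=
  forall p : seq T, 2 < size p -> ucycle e p -> ~ {subset p <= X}.

Lemma nbrsE v X : nbrs v X = \sum_(y in X) e v y.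
Proof.
rewrite /nbrs -sum1_card big_mkcond [RHS]big_mkcond; apply: eq_bigr => y _.
by rewrite inE; case: (y \in X); case: (e v y).
Qed.

Lemma nbrs_sub v (X Y : {set T}) : X \subset Y -> nbrs v X <= nbrs v Y.
Proof.
move=> sXY; apply/subset_leq_card/subsetP => y; rewrite !inE.
by case/andP=> /(subsetP sXY) -> ->.
Qed.

Lemma nbrsID v (X Y : {set T}) : nbrs v (X :&: Y) + nbrs v (X :\: Y) = nbrs v X.
Proof.
rewrite /nbrs -(cardsID Y [set y in X | e v y]); congr (_ + _); apply: eq_card => y.
  by rewrite !inE andbAC.
by rewrite !inE andbA.
Qed.

Lemma nbrs_subD v (X Y : {set T}) :
  Y \subset X -> nbrs v Y + nbrs v (X :\: Y) = nbrs v X.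
Proof. by move=> /setIidPr {1}<-; apply: nbrsID. Qed.

Lemma nbrsU1_le v w (X : {set T}) : nbrs v (w |: X) <= nbrs v X + e v w.
Proof.
rewrite /nbrs; case vw: (e v w).
  apply: (@leq_trans #|w |: [set y in X | e v y]|); last first.
    by rewrite cardsU1 addnC leq_add2l leq_b1.
  by apply/subset_leq_card/subsetP => y; rewrite !inE; case: (y == w).
rewrite addn0; apply/subset_leq_card/subsetP => y; rewrite !inE.
by case: eqP => [->|_] //=; rewrite vw andbF.
Qed.

Lemma forest_sub (X Y : {set T}) : X \subset Y -> forest Y -> forest X.
Proof. by move=> sXY fY p p3 pc pX; apply: (fY p) => // v /pX/(subsetP sXY). Qed.

Lemma forest0 : forest set0.
Proof. by move=> [|v p] //= _ _ /(_ v); rewrite mem_head inE => /(_ isT). Qed.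

Hypotheses (e_sym : symmetric e) (e_irr : irreflexive e).

Lemma cycle_nbrs (p : seq T) v : 2 < size p -> ucycle e p -> v \in p ->
  exists a b, [/\ a != b, a \in p, b \in p, e v a & e v b].
Proof.
move=> p3 /andP[pc pu] /rot_to[i q eq_q].
have mq x : x \in v :: q -> x \in p by rewrite -eq_q mem_rot.
move: p3 pc pu; rewrite -(size_rot i) -(rot_cycle i) -(rot_uniq i) {}eq_q.
case: q mq => [|a [|b q]] //= mq _; rewrite rcons_path /= => /and4P[va _ _ bv].
case/and4P=> _ aq _ _; exists a, (last b q); split => //.
- by apply: contraNneq aq => ->; apply: mem_last.
- by rewrite mq // !inE eqxx orbT.
- by rewrite mq // in_cons in_cons mem_last !orbT.
- by rewrite e_sym.
Qed.

(** A new vertex with at most one neighbour is a leaf and lies on no cycle. *)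
Lemma forest_leaf (v : T) (X : {set T}) : nbrs v X <= 1 -> forest X -> forest (v |: X).
Proof.
move=> v1 fX p p3 pc pX; have [vp|vp] := boolP (v \in p); last first.
  apply: (fX p p3 pc) => u up; move: (pX u up); rewrite !inE.
  by case: eqP up => [->|//]; rewrite (negPf vp).
have [a [b [ab ap bp va vb]]] := cycle_nbrs p3 pc vp.
have inX c : c \in p -> e v c -> c \in X.
  by move=> /pX; rewrite !inE; case: eqP => [->|//]; rewrite e_irr.
suff : 2 <= nbrs v X by rewrite leqNgt ltnS v1.
rewrite -(_ : #|[set a; b]| = 2); last by rewrite cards2 ab.
by apply/subset_leq_card/subsetP => c; rewrite !inE => /orP[]/eqP->; rewrite inX.
Qed.

(** A vertex isolated in [X] has at most the neighbour [w] in [w |: X], so putting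
    it back closes no cycle. *)
Lemma forest_restore_isolated (w x : T) (X D : {set T}) : x \in D -> forest X ->
  forest ((w |: X) :\: D) -> nbrs x X = 0 -> forest ((w |: X) :\: (D :\ x)).
Proof.
move=> xD fX fD x0 p p3 pc pX.
have [xp|xp] := boolP (x \in p); last first.
  apply: (fD p p3 pc) => u up; move: (pX u up); rewrite !inE.
  by case: eqP up => [->|]//=; rewrite (negPf xp).
have [a [b [ab ap bp xa xb]]] := cycle_nbrs p3 pc xp.
have only_w c : c \in p -> e x c -> c == w.
  move=> cp xc; move: (pX c cp); rewrite !inE => /andP[_ /orP[//|cX]].
  by move/cards0_eq/setP/(_ c): x0; rewrite !inE cX xc.
by move: ab; rewrite (eqP (only_w _ ap xa)) eq_sym (only_w _ bp xb).
Qed.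

Lemma sum_nbrs_sym (X Y : {set T}) :
  \sum_(v in X) nbrs v Y = \sum_(v in Y) nbrs v X.
Proof.
under eq_bigr do rewrite nbrsE; rewrite exchange_big; apply: eq_bigr => y _.
by rewrite nbrsE; apply: eq_bigr => x _; rewrite e_sym.
Qed.

(** How a class may change along a chain of moves: it loses vertices, and gains
    at most one, as a leaf. *)
Definition grows (X Y : {set T}) : Prop :=
  Y \subset X \/ exists2 y, nbrs y X <= 1 & Y \subset y |: X.

Lemma forest_grows (X Y : {set T}) : grows X Y -> forest X -> forest Y.
Proof.
case=> [sYX|[y y1 sY]] fX; first exact: forest_sub fX.
exact: forest_sub sY (forest_leaf y1 fX).
Qed.

Lemma grows_restrict (X Y X' Y' : {set T}) :
  grows X Y -> X' \subset X -> Y' \subset Y -> Y' :&: X \subset X' -> grows X' Y'.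
Proof.
move=> gXY sX' sY' sYX; case: gXY => [sYX0|[y y1 sYy]]; [left|right].
  by apply: subset_trans sYX; rewrite subsetI subxx (subset_trans sY').
exists y; first exact: leq_trans (nbrs_sub _ sX') y1.
apply/subsetP => v vY; have := subsetP sYy v (subsetP sY' v vY); rewrite !inE.
by case/orP=> [->//|vX]; rewrite (subsetP sYX) ?orbT // inE vY.
Qed.

(** * Colour classes and chains of moves *)

Section Colouring.

Variable C : finType.
Implicit Types (S U M : {set T}) (A K : {set C}) (phi : T -> C).

Definition cls U phi (j : C) : {set T} := [set v in U | phi v == j].

Definition upd phi (v : T) (j : C) : T -> C := fun u => if u == v then j else phi u.

Lemma card_cls U A phi : {in U, forall v, phi v \in A} ->
  \sum_(j in A) #|cls U phi j| = #|U|.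
Proof.
move=> UA; rewrite -sum1_card (partition_big phi (mem A)) //=.
by apply: eq_bigr => j _; rewrite -sum1_card; apply: eq_bigl => v; rewrite inE.
Qed.

Lemma sum_nbrs_cls v U A phi : {in U, forall v, phi v \in A} ->
  \sum_(j in A) nbrs v (cls U phi j) = nbrs v U.
Proof.
move=> UA; rewrite /nbrs -(@card_cls [set y in U | e v y] A phi).
  by apply: eq_bigr => j _; apply: eq_card => y; rewrite !inE andbAC.
by move=> y; rewrite inE => /andP[/UA].
Qed.

Lemma cls_upd_in S phi v j i : v \in S ->
  cls S (upd phi v j) i = if i == j then v |: cls S phi i else cls S phi i :\ v.
Proof.
move=> vS; apply/setP => u; rewrite !inE /upd; case: (eqVneq u v) => [->|uv].
  by rewrite vS /= eq_sym; case: eqP => [->|]; rewrite !inE ?eqxx.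
by case: ifP; rewrite !inE ?(negPf uv).
Qed.

Lemma cls_upd_new S phi v j i : v \notin S ->
  cls (v |: S) (upd phi v j) i = if i == j then v |: cls S phi i else cls S phi i.
Proof.
move=> vS; apply/setP => u; rewrite !inE /upd; case: (eqVneq u v) => [->|uv].
  by rewrite /= eq_sym; case: eqP => [->|]; rewrite !inE ?eqxx // (negPf vS).
by case: ifP; rewrite !inE ?(negPf uv).
Qed.

(** The movers are restricted to [M] while neighbours are counted in [S]: this
    allows a vertex of [S] to block moves without ever moving itself. *)
Lemma cls_new v U phi j : v \notin U ->
  cls (v |: U) phi j = if phi v == j then v |: cls U phi j else cls U phi j.
Proof.
move=> vU; apply/setP => u; case: eqP => [<-|vj]; rewrite !inE.
  by case: eqP => [->|//]; rewrite eqxx.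
by case: eqP => [->|//]; rewrite (negPf vU); case: eqP.
Qed.

Definition gives M S A phi : rel C :=
  fun i j => (j \in A) && [exists v in M, (phi v == i) && (nbrs v (cls S phi j) <= 1)].


(** The moves are made from the end of the path backwards.  As the path is simple,
    a class has only lost vertices when it receives its own. *)
Lemma shift_path M S A phi i p : M \subset S ->
  path (gives M S A phi) i p -> uniq (i :: p) ->
  exists psi, [/\ forall v, psi v = phi v \/ v \in M /\ psi v \in A,
    forall j, #|cls S psi j| + (j == i) = #|cls S phi j| + (j == last i p),
    cls S psi i \subset cls S phi i,
    forall j, j \notin i :: p -> cls S psi j = cls S phi j
    & forall j, grows (cls S phi j) (cls S psi j)].
Proof.
move=> sMS; elim: p i => [|k p IHp] i /=.
  by move=> _ _; exists phi; split=> // *; left.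
case/andP=> /andP[kA /existsP[v /and3P[vM /eqP vi vk]]] /IHp{}IHp.
rewrite inE negb_or -andbA => /and3P[ik ip /IHp[psi [psi1 psi2 psi3 psi4 psi5]]].
have i_kp : i \notin k :: p by rewrite inE negb_or ik.
have vS := subsetP sMS v vM.
have vci : v \in cls S psi i by rewrite psi4 // inE vS vi eqxx.
have vnk : v \notin cls S psi k.
  by move: vci; rewrite !inE => /andP[_ /eqP->]; rewrite (negPf ik) andbF.
exists (upd psi v k); split.
- move=> u; rewrite /upd; case: eqP => [->|_]; first by right.
  exact: psi1.
- move=> j; rewrite cls_upd_in //; have := psi2 j.
  case: (eqVneq j k) => [->|jk].
    by rewrite cardsU1 vnk (eq_sym k i) (negPf ik) addn0 addnC.
  have -> : (j == i) = (v \in cls S psi j) :> nat.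
    by move: vci; rewrite !inE vS /= => /eqP->; rewrite eq_sym.
  by rewrite addn0 => <-; rewrite [RHS](cardsD1 v) addnC.
- by rewrite cls_upd_in // (negPf ik) psi4 // subD1set.
- move=> j; rewrite !inE !negb_or => /and3P[ji jk jp]; rewrite cls_upd_in // (negPf jk).
  rewrite psi4 ?inE ?negb_or ?jk //; apply/setP => u; rewrite !inE.
  by case: eqP => //= ->; rewrite vi eq_sym (negPf ji) andbF.
- move=> j; rewrite cls_upd_in //; case: eqP => [->|_].
    right; exists v => //; exact: setUS.
  case: (psi5 j) => [sj|[y y1 sj]]; [left|right; exists y => //];
    exact: subset_trans (subD1set _ _) sj.
Qed.


Definition reach M S A phi (P : pred C) : {set C} :=
  [set i in A | [exists k in A, P k && connect (gives M S A phi) i k]].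

Lemma reach_sub M S A phi P : reach M S A phi P \subset A.
Proof. by apply/subsetP => i; rewrite inE => /andP[]. Qed.

Lemma reach_target M S A phi (P : pred C) k :
  k \in A -> P k -> k \in reach M S A phi P.
Proof.
by move=> kA Pk; rewrite inE kA; apply/existsP; exists k; rewrite kA Pk connect0.
Qed.

Lemma reach_stuck M S A phi P v j : v \in M -> phi v \in A ->
  phi v \notin reach M S A phi P -> j \in reach M S A phi P ->
  2 <= nbrs v (cls S phi j).
Proof.
move=> vM vA; rewrite !inE vA /= => nv /andP[jA /existsP[k /and3P[kA Pk jk]]].
rewrite ltnNge; apply: contra nv => v1; apply/existsP; exists k; rewrite kA Pk /=.
apply: connect_trans jk; apply: connect1; rewrite /gives jA.
by apply/existsP; exists v; rewrite vM eqxx.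
Qed.

Lemma shift M S A phi P i : M \subset S -> i \in reach M S A phi P ->
  exists psi k, [/\ k \in A /\ P k,
    forall v, psi v = phi v \/ v \in M /\ psi v \in A,
    forall j, #|cls S psi j| + (j == i) = #|cls S phi j| + (j == k),
    cls S psi i \subset cls S phi i
    & forall j, grows (cls S phi j) (cls S psi j)].
Proof.
move=> sMS; rewrite inE => /andP[iA /existsP[k /and3P[kA Pk /connectP[p ip ek]]]].
case: (shortenP ip) ek => q iq uq _ ek.
have [psi [? psi2 ? _ ?]] := shift_path sMS iq uq.
by exists psi, k; split=> //; rewrite ek.
Qed.

(** * Colourings within capacities *)

Variable c : C -> nat.

Definition fits U A phi : Prop :=
  [/\ {in U, forall v, phi v \in A},
      forall j, j \in A -> forest (cls U phi j)
    & forall j, j \in A -> #|cls U phi j| <= c j].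

Definition part U phi A : {set T} := [set v in U | phi v \in A].

Lemma cls_part U phi A j : j \in A -> cls (part U phi A) phi j = cls U phi j.
Proof.
move=> jA; apply/setP => v; rewrite !inE; case: eqP => [->|_]; last by rewrite !andbF.
by rewrite jA andbT.
Qed.

Lemma part_sub U phi A : part U phi A \subset U.
Proof. by apply/subsetP => v; rewrite inE => /andP[]. Qed.

Lemma nbrs_part v U phi A : nbrs v (part U phi A) = \sum_(j in A) nbrs v (cls U phi j).
Proof.
rewrite -(@sum_nbrs_cls v (part U phi A) A phi); last first.
  by move=> u; rewrite inE => /andP[].
by apply: eq_bigr => j jA; rewrite cls_part.
Qed.

Lemma card_diff_part S U A A' phi : U \subset S -> {in U, forall v, phi v \in A} ->
  #|S :\: part U phi A'| = #|S :\: U| + \sum_(i in A :\: A') #|cls U phi i|.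
Proof.
move=> sUS UA; rewrite -(cardsID U) addnC; congr (_ + _).
  by apply: eq_card => v; rewrite !inE; case: (v \in U).
have eU : (S :\: part U phi A') :&: U = part U phi (A :\: A').
  apply/setP => v; rewrite !inE; case vU: (v \in U); last by rewrite !andbF.
  by rewrite (subsetP sUS v vU) UA //= !andbT.
rewrite eU -(@card_cls (part U phi (A :\: A')) (A :\: A') phi).
  by apply: eq_bigr => j jA; rewrite cls_part.
by move=> v; rewrite inE => /andP[].
Qed.

Lemma notin_part v S U phi A : v \in S :\: part U phi A ->
  v \in S :\: U \/ v \in U /\ phi v \notin A.
Proof.
rewrite !inE negb_and => /andP[+ vS]; rewrite vS andbT.
by case: (v \in U) => /= [vA|_]; [right | left].
Qed.

Lemma fits_part U A A' phi :
  A' \subset A -> fits U A phi -> fits (part U phi A') A' phi.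
Proof.
move=> sA [_ fo le]; split=> [v|j jA|j jA]; first by rewrite inE => /andP[].
  by rewrite cls_part //; apply: fo; apply: subsetP jA.
by rewrite cls_part //; apply: le; apply: subsetP jA.
Qed.

Definition deficient U phi : pred C := fun k => #|cls U phi k| < c k.

(** Class [i] first passes a vertex on towards a class with room and receives
    [y] afterwards. *)
Lemma insert_vertex U A phi y i : fits U A phi -> y \notin U ->
  i \in reach U U A phi (deficient U phi) -> forest (y |: cls U phi i) ->
  exists psi, fits (y |: U) A psi.
Proof.
move=> [UA fo le] yU ir fy; have iA := subsetP (reach_sub _ _ _ _ _) i ir.
have [psi [k [[kA dk] psi1 psi2 psi3 psi4]]] := shift (subxx U) ir.
exists (upd psi y i); split=> [v|j jA|j jA].
- rewrite !inE /upd; case: eqP => //= _ vU.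
  by case: (psi1 v) => [->|[]//]; apply: UA.
- rewrite cls_upd_new //; case: eqP => [->|_]; last first.
    exact: forest_grows (psi4 j) (fo j jA).
  by apply: forest_sub fy; apply: setUS.
- rewrite cls_upd_new //; have := psi2 j; have := le j jA; move: dk; rewrite /deficient.
  case: (eqVneq j i) => [->|_].
    rewrite cardsU1; have -> : y \notin cls U psi i by rewrite inE negb_and yU.
    by case: eqP => [<-|_]; lia.
  by case: eqP => [<-|_]; lia.
Qed.

Lemma fits_merge S U K A phi psi : U \subset S -> A \subset K ->
  fits U A phi -> fits (S :\: U) (K :\: A) psi -> exists chi, fits S K chi.
Proof.
move=> sUS sAK [UA fo le] [UA' fo' le'].
exists (fun v => if v \in U then phi v else psi v).
have cE j : j \in K -> cls S (fun v => if v \in U then phi v else psi v) j =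
    if j \in A then cls U phi j else cls (S :\: U) psi j.
  move=> jK; apply/setP => v; case: ifP => jA; rewrite !inE; case: ifP => vU //=.
  - by rewrite (subsetP sUS).
  - apply/negP => /andP[vS /eqP vj]; have := UA' v; rewrite !inE vU vS vj jA.
    by move/(_ isT).
  - by apply/negP => /andP[vS /eqP vj]; move: (UA v vU); rewrite vj jA.
split=> [v vS|j jK|j jK].
- case: ifP => vU; first by apply: (subsetP sAK); apply: UA.
  by have := UA' v; rewrite !inE vU vS => /(_ isT)/andP[].
- by rewrite cE //; case: ifP => jA; [apply: fo | apply: fo'; rewrite inE jA].
- by rewrite cE //; case: ifP => jA; [apply: le | apply: le'; rewrite inE jA].
Qed.

(** The obstruction: the colours of [A] suffice for [U], the vertices outside
    [U] exceed the capacity of the other colours by one, and none of them can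
    move into a class of [A].  Only [U] is fixed here; its colouring may change,
    and the degrees into [U] do not depend on it ([config_nbrs]). *)
Definition config S K A U : Prop :=
  [/\ A \subset K, U \subset S, #|S :\: U| = (\sum_(i in K :\: A) c i).+1
    & exists phi, fits U A phi /\
        forall v j, v \in S :\: U -> j \in A -> 2 <= nbrs v (cls U phi j)].

Lemma config_nbrs S K A U v : config S K A U -> v \in S :\: U -> 2 * #|A| <= nbrs v U.
Proof.
case=> _ _ _ [phi [[UA _ _] h2]] vS; rewrite -(sum_nbrs_cls v UA).
by rewrite mulnC -sum_nat_const; apply: leq_sum => j jA; apply: h2.
Qed.

(** Passing from [A] to [A'] keeps the surplus equal to one because the
    discarded classes are full. *)
Lemma card_part_full S K A A' U phi : A \subset K -> U \subset S ->
  #|S :\: U| = (\sum_(i in K :\: A) c i).+1 -> fits U A phi -> A' \subset A ->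
  (forall i, i \in A :\: A' -> ~~ deficient U phi i) ->
  #|S :\: part U phi A'| = (\sum_(i in K :\: A') c i).+1.
Proof.
move=> sAK sUS cS [UA fo le] sA full.
rewrite (card_diff_part _ sUS UA) cS addSn; congr _.+1.
rewrite [RHS](big_setID (K :\: A)) /=.
have -> : (K :\: A') :&: (K :\: A) = K :\: A.
  apply/setP => i; rewrite !inE; move: (subsetP sA i).
  by case: (i \in A') => [/(_ isT)->|_]; case: (i \in A); case: (i \in K).
have -> : (K :\: A') :\: (K :\: A) = A :\: A'.
  apply/setP => i; rewrite !inE; move: (subsetP sAK i).
  by case: (i \in A) => [/(_ isT)->|_]; case: (i \in A'); case: (i \in K).
congr (_ + _); apply: eq_bigr => i /[dup] /full di; rewrite inE => /andP[_ iA].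
by apply/eqP; rewrite eqn_leq le //= leqNgt.
Qed.

Lemma subconfig S K A A' U phi : A \subset K -> U \subset S ->
  #|S :\: U| = (\sum_(i in K :\: A) c i).+1 -> fits U A phi -> A' \subset A ->
  (forall i, i \in A :\: A' -> ~~ deficient U phi i) ->
  (forall v j, v \in S :\: part U phi A' -> j \in A' -> 2 <= nbrs v (cls U phi j)) ->
  config S K A' (part U phi A').
Proof.
move=> sAK sUS cS fU sA full h2; split.
- exact: subset_trans sAK.
- exact: subset_trans (part_sub _ _ _) sUS.
- exact: card_part_full fU _ full.
- exists phi; split; first exact: fits_part fU.
  by move=> v j vS jA; rewrite cls_part //; apply: h2.
Qed.

(** The classes that reach a class with room either admit a further vertex, or
    are closed and form an obstruction themselves. *)
Lemma augment_or_config S K A U phi (A' := reach U U A phi (deficient U phi)) :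
  A \subset K -> U \subset S -> #|S :\: U| = (\sum_(i in K :\: A) c i).+1 ->
  fits U A phi ->
  (exists2 y, y \in S :\: U & exists psi, fits (y |: U) A psi) \/
  config S K A' (part U phi A') /\
  (forall v j, v \in S :\: U -> j \in A' -> 2 <= nbrs v (cls U phi j)).
Proof.
move=> sAK sUS cS fU.
case: (boolP [exists v in S :\: U, [exists j in A', nbrs v (cls U phi j) <= 1]]).
  case/existsP=> y /andP[yS /existsP[j /andP[jA y1]]]; left; exists y => //.
  have yU : y \notin U by move: yS; rewrite inE => /andP[].
  apply: (insert_vertex fU yU jA); apply: forest_leaf y1 _.
  by case: fU => _ fo _; apply: fo; apply: subsetP (reach_sub _ _ _ _ _) _ jA.
rewrite negb_exists => /forallP none; right.
have st v j : v \in S :\: U -> j \in A' -> 2 <= nbrs v (cls U phi j).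
  move=> vS jA; have := none v; rewrite vS negb_exists => /forallP/(_ j).
  by rewrite jA /= -ltnNge.
split=> //; apply: (@subconfig S K A A' U phi) => //; first exact: reach_sub.
  by move=> i /setDP[iA]; apply: contra; apply: reach_target.
move=> v j /notin_part[vS|[vU vA']] jA; first exact: st.
by apply: (reach_stuck vU) vA' jA; case: fU => UA _ _; apply: UA.
Qed.

(** * Removing an obstruction *)

Section Step.

Variables (Delta s : nat).
Hypothesis Delta_max : forall v (X : {set T}), nbrs v X <= Delta.
Hypothesis c_bounds : forall i, s <= c i <= s.+1.

Variables (S : {set T}) (K : {set C}) (F : {set T}).
Hypothesis S_small : #|S| <= \sum_(i in K) c i.
Hypothesis S_deg : forall v, v \in S -> nbrs v S + 2 <= 2 * #|K| + (v \in F).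
Hypothesis s_large : 2 * #|K| + (2 * Delta + 1) * #|F| <= s.
Hypothesis smaller : forall (S' F' : {set T}) (K' : {set C}), #|K'| < #|K| ->
  #|S'| <= \sum_(i in K') c i ->
  (forall v, v \in S' -> nbrs v S' + 2 <= 2 * #|K'| + (v \in F')) ->
  #|F'| <= #|F| + Delta -> exists psi, fits S' K' psi.

(** Once the colours of [A] take one more vertex, the rest has the right size for
    the other colours.  The vertices of [N] may have one neighbour in [U] too few
    and become exceptional; as [N] is disjoint from [F], their excess is one. *)
Lemma extend_by_smaller A U (N : {set T}) y psi :
  0 < #|A| -> A \subset K -> U \subset S ->
  #|S :\: U| = (\sum_(i in K :\: A) c i).+1 ->
  y \in S :\: U -> fits (y |: U) A psi -> #|N| <= Delta -> [disjoint N & F] ->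
  (forall v, v \in S :\: U -> 2 * #|A| <= nbrs v U + (v \in N)) ->
  exists chi, fits S K chi.
Proof.
move=> A0 sAK sUS cS yS fU N_le dNF deg.
have sSU : S :\: (y |: U) \subset S :\: U by apply: setDS; apply: subsetUr.
have cK : #|K :\: A| + #|A| = #|K|.
  by rewrite -(cardsID A K) (setIidPr sAK) addnC.
case: (@smaller (S :\: (y |: U)) (F :|: N) (K :\: A)).
- by lia.
- have : #|S :\: U| = #|S :\: (y |: U)|.+1.
    by rewrite (cardsD1 y) yS setDDl setUC.
  by rewrite cS => -[->].
- move=> v vS; have vS' := subsetP sSU v vS; have := deg v vS'.
  have vS'' : v \in S by move: vS; rewrite inE => /andP[].
  have := S_deg vS''; rewrite -(nbrs_subD v sUS).
  have : (v \in F) + (v \in N) <= (v \in F :|: N).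
    rewrite inE; case vF: (v \in F); case vN: (v \in N) => //.
    by rewrite (disjointFr dNF vN) in vF.
  have := nbrs_sub v sSU; rewrite -cK; move: (nbrs v _) (nbrs v _) (nbrs v _).
  by move: #|A| #|_| (nat_of_bool _) (nat_of_bool _) (nat_of_bool _); clear; lia.
- by rewrite cardsU; lia.
move=> chi fchi; apply: fits_merge fU fchi => //.
by apply/subsetP => v; rewrite !inE => /orP[/eqP->|/(subsetP sUS)//]; case/setDP: yS.
Qed.

Section Minimal.

Variables (A : {set C}) (U : {set T}).
Hypothesis conf : config S K A U.
Hypothesis below : forall A' U', config S K A' U' -> #|A'| < #|A| ->
  exists chi, fits S K chi.

Let a := #|A|.

Lemma config_pos : 0 < a.
Proof.
case: conf => sAK sUS cS [phi [[UA fo le] _]]; rewrite lt0n; apply/eqP.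
move/cards0_eq=> A0; have U0 : U = set0.
  by apply/setP => v; rewrite inE; apply/negP => /UA; rewrite A0 inE.
by move: cS S_small; rewrite U0 A0 !setD0 => ->; rewrite ltnn.
Qed.

Lemma sub_config_eq A' U' : config S K A' U' -> A' \subset A ->
  (exists chi, fits S K chi) \/ A' = A.
Proof.
move=> c' sA; case: (ltnP #|A'| a) => [lt|ge]; first by left; apply: below c' lt.
by right; apply/eqP; rewrite eqEcard sA.
Qed.

(** By minimality every class of [A] reaches a class with room, whichever
    colouring of [U] is used. *)
Lemma full_reach phi : fits U A phi ->
  (exists chi, fits S K chi) \/
  reach U U A phi (deficient U phi) = A /\
  (forall v j, v \in S :\: U -> j \in A -> 2 <= nbrs v (cls U phi j)).
Proof.
move=> fU; have [sAK sUS cS _] := conf.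
case: (augment_or_config sAK sUS cS fU) => [[y yS [psi fpsi]]|[c' st]].
  left; apply: (@extend_by_smaller A U set0 y psi) => //; first exact: config_pos.
  - by rewrite cards0.
  - by rewrite -setI_eq0 set0I.
  - by move=> v vS; rewrite inE addn0; apply: config_nbrs conf vS.
case: (sub_config_eq c' (reach_sub _ _ _ _ _)); first by left.
by move=> eA; right; split => // v j vS jA; apply: st; rewrite ?eA.
Qed.


(** The threshold depends on [U] only and not on its colouring, so density
    survives recolouring.  The successor stands for [2 * a - 1 <= nbrs v U]. *)
Definition dense : {set T} := [set v in U | 2 * a <= (nbrs v U).+1].

(** Otherwise each outside vertex without neighbours in [F] would send two edges to
    the dense vertices of class [W], and these receive at most [2 * b - 1] edges
    each, one more at the vertices of [F], where [b] is the number of the other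
    colours: about [2 * b * s] edges against [(2 * b - 1) * s], where [s] is the
    size of a class.  Outside vertices next to [F] are paid for by the edges at
    [F]. *)
Lemma good_vertex phi W : fits U A phi -> W \in A ->
  exists w, [/\ w \in S :\: U, nbrs w F = 0 & nbrs w (cls U phi W :&: dense) <= 1].
Proof.
move=> [UA fo le] WA; have [sAK sUS cS _] := conf.
set X := _ :&: dense.
case: (boolP [exists w in S :\: U, (nbrs w F == 0) && (nbrs w X <= 1)]).
  by case/existsP=> w /and3P[wS /eqP w0 w1]; exists w.
rewrite negb_exists => /forallP none; exfalso.
have B_lo : 2 * #|S :\: U| <=
    \sum_(v in X) nbrs v (S :\: U) + 2 * \sum_(v in F) nbrs v (S :\: U).
  rewrite -!(sum_nbrs_sym (S :\: U)) mulnC -sum_nat_const big_distrr -big_split /=.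
  apply: leq_sum => w wS; have := none w; rewrite wS /= negb_and -ltnNge -lt0n.
  by case/orP; lia.
have F_hi : \sum_(v in F) nbrs v (S :\: U) <= #|F| * Delta.
  by rewrite -sum_nat_const; apply: leq_sum => v _; apply: Delta_max.
have cK : #|K :\: A| + a = #|K|.
  by rewrite -(cardsID A K) (setIidPr sAK) addnC.
have X_hi : \sum_(v in X) nbrs v (S :\: U) <=
    #|X| * (2 * #|K :\: A|).-1 + \sum_(v in X) (v \in F).
  rewrite -sum_nat_const -big_split /=; apply: leq_sum => v.
  rewrite !inE => /andP[/andP[vU _]] /andP[_ dv].
  by have := S_deg (subsetP sUS v vU); rewrite -(nbrs_subD v sUS); lia.
have XF : \sum_(v in X) (v \in F) <= #|F|.
  rewrite -sum1_card big_mkcond [leqRHS]big_mkcond; apply: leq_sum => v _.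
  by case: (v \in X); case: (v \in F).
have X_le : #|X| <= s.+1.
  have /andP[_ cW] := c_bounds W.
  apply: leq_trans (subset_leq_card (subsetIl _ _)) _.
  exact: leq_trans (le W WA) cW.
have B_big : #|K :\: A| * s < #|S :\: U|.
  rewrite cS ltnS -sum_nat_const; apply: leq_sum => i _.
  by case/andP: (c_bounds i).
have K_big : 0 < #|K :\: A|.
  have /card_gt0P[v vS] : 0 < #|S :\: U| by rewrite cS.
  have := config_nbrs conf vS; have := nbrs_sub v sUS.
  rewrite -/a; case/setDP: vS => /S_deg + _; have := leq_b1 (v \in F); lia.
move: K_big B_big X_hi cK s_large; rewrite -/a; case: #|_ :\: A| => // b _.
move=> B_big X_hi cK s_big.
have : #|X| * (2 * b.+1).-1 <= s.+1 * (2 * b.+1).-1 by rewrite leq_mul2r X_le orbT.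
rewrite (_ : (2 * b.+1).-1 = 2 * b + 1); last lia.
nia.
Qed.


Section Enter.

Variables (w : T) (W : C).
Hypotheses (wB : w \in S :\: U) (wF : nbrs w F = 0) (WA : W \in A).

Let solved := exists chi, fits S K chi.

Let wU : w \notin U.
Proof. by case/setDP: wB. Qed.

(** The classes from which a vertex can be passed on to a class with room or to
    [W] while [w] counts as a vertex of [W].  No vertex leaves [W], so that the
    vertices waiting there to be moved out stay in place. *)
Definition accepting phi : {set C} :=
  reach (U :\: cls U phi W) (w |: U) A (upd phi w W)
    (fun k => deficient U phi k || (k == W)).

Let moversU phi : U :\: cls U phi W \subset w |: U.
Proof. exact: subset_trans (subsetDl _ _) (subsetUr _ _). Qed.

(** [X] passes a vertex on and takes [x] instead.  If a vertex arrives in [W], it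
    is a leaf of [w |: W], so [D :\ x] still meets every cycle there. *)
Lemma swap_out phi (D : {set T}) x X : fits U A phi -> D \subset cls U phi W ->
  forest ((w |: cls U phi W) :\: D) -> x \in D -> X != W ->
  nbrs x (cls U phi X) <= 1 -> X \in accepting phi ->
  exists chi, [/\ fits U A chi, D :\ x \subset cls U chi W
                & forest ((w |: cls U chi W) :\: (D :\ x))].
Proof.
move=> [UA fo le] sDW fD xD XW x1 Xacc.
have XA := subsetP (reach_sub _ _ _ _ _) X Xacc.
have := subsetP sDW x xD; rewrite inE => /andP[xU /eqP xW].
have [psi [k [[kA Pk] psi1 psi2 psi3 psi4]]] := shift (moversU phi) Xacc.
have psiW : psi w = W.
  case: (psi1 w) => [->|[]]; first by rewrite /upd eqxx.
  by rewrite !inE (negPf wU) andbF.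
have psi_cW v : v \in cls U phi W -> psi v = W.
  move=> vW; have := vW; rewrite inE => /andP[vU /eqP phiv].
  case: (psi1 v) => [->|[]]; last by rewrite inE vW.
  by rewrite /upd; case: eqP.
have xW' : psi x = W by apply: psi_cW; apply: subsetP xD.
have old j : cls (w |: U) (upd phi w W) j =
    if j == W then w |: cls U phi j else cls U phi j by exact: cls_upd_new.
have new j : cls (w |: U) psi j = if j == W then w |: cls U psi j else cls U psi j.
  by rewrite cls_new // psiW eq_sym.
have sz j : #|cls U psi j| + (j == X) = #|cls U phi j| + (j == k).
  have := psi2 j; rewrite old new; case: ifP => // _.
  by rewrite !cardsU1 !inE (negPf wU) /= -!addnA add1n => -[].
have szW : #|cls U psi W| = (#|cls U psi W :\ x|).+1.
  by rewrite (cardsD1 x) inE xU xW' eqxx.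
have sW : cls U phi W \subset cls U psi W.
  apply/subsetP => v vW; rewrite inE (psi_cW v vW) eqxx andbT.
  by move: vW; rewrite inE => /andP[].
have gW : grows (w |: cls U phi W) (w |: cls U psi W).
  by have := psi4 W; rewrite old new eqxx.
have g j : j != W -> grows (cls U phi j) (cls U psi j).
  by move=> jW; have := psi4 j; rewrite old new (negPf jW).
have clsE j : cls U (upd psi x X) j =
    if j == X then x |: cls U psi j else cls U psi j :\ x by exact: cls_upd_in.
have k_room : k != W -> #|cls U phi k| < c k by move: Pk => /orP[|->].
exists (upd psi x X); split; first split=> [v vU|j jA|j jA].
- rewrite /upd; case: eqP => // _; case: (psi1 v) => [->|[]//].
  by rewrite /upd; case: eqP => // _; apply: UA.
- rewrite clsE; case: (eqVneq j X) => [->|jX].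
    apply: (@forest_sub _ (x |: cls U phi X)); last exact: forest_leaf x1 (fo X XA).
    by apply: setUS; move: psi3; rewrite old new (negPf XW).
  apply: forest_sub (subD1set _ _) _; case: (eqVneq j W) => [->|jW].
    apply: forest_grows (fo W WA); apply: grows_restrict gW _ _ _.
    + exact: subsetUr.
    + exact: subsetUr.
    + apply/subsetP => v; rewrite !inE => /andP[/andP[vU _]].
      by case: eqP vU => [->|//]; rewrite (negPf wU).
  exact: forest_grows (g j jW) (fo j jA).
- rewrite clsE; have := sz j; have := le j jA.
  case: (eqVneq j X) => [->|jX].
    have xX : x \notin cls U psi X by rewrite inE xW' eq_sym (negPf XW) andbF.
    rewrite cardsU1 xX addnC => leX ->.
    case: (eqVneq X k) => [Xk|_]; last by rewrite addn0.
    by rewrite addn1 Xk k_room // -Xk.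
  rewrite addn0; case: (eqVneq j W) => [->|jW] lej szj.
    by apply: leq_trans lej; rewrite -ltnS -szW szj -addn1 leq_add2l leq_b1.
  apply: leq_trans (subset_leq_card (subD1set _ _)) _; rewrite szj.
  case: (eqVneq j k) => [jk|_]; last by rewrite addn0.
  by rewrite addn1 jk k_room // -jk.
- rewrite clsE eq_sym (negPf XW); apply: setSD; exact: subset_trans sW.
- rewrite clsE eq_sym (negPf XW).
  apply: (forest_grows _ fD); apply: grows_restrict gW _ _ _.
  + exact: subsetDl.
  + by apply: subset_trans (subsetDl _ _) _; apply: setUS; apply: subD1set.
  + have xw : x != w by apply: contraNneq wU => <-.
    apply/subsetP => v /setIP[/setDP[v1 v2] v3]; apply/setDP; split=> //.
    apply: contra v2 => vD; rewrite in_setD1 vD andbT; apply: contraTneq v1 => ->.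
    by rewrite !inE eqxx (negPf xw).
Qed.

(** If some class is not accepting, the accepting classes [B] are fewer than [A]
    and keep out all vertices except neighbours of [w], which class [W] may admit.
    Two appeals to minimality finish: some vertex [y] outside can
    move into [W], since otherwise [B] would be a smaller obstruction; and [W] can
    pass a vertex on to a class with room inside [B], since otherwise
    the classes of [B] that can do so would be one. *)
Lemma solved_if_blocked phi X : fits U A phi -> X \in A -> X \notin accepting phi ->
  solved.
Proof.
move=> fU XA Xacc; have [sAK sUS cS _] := conf; have [UA fo le] := fU.
case: (full_reach fU) => [//|[_ st]].
set B := accepting phi in Xacc.
have sBA : B \subset A by apply: reach_sub.
have WB : W \in B by apply: reach_target => //; rewrite eqxx orbT.
have full : forall i, i \in A :\: B -> ~~ deficient U phi i.
  by move=> i /setDP[iA]; apply: contra => di; apply: reach_target; rewrite ?di.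
have stB v j : v \in U -> phi v \notin B -> j \in B ->
    2 <= nbrs v (cls U phi j) + (j == W) * e v w.
  move=> vU vB jB; have vW : phi v != W by apply: contraNneq vB => ->.
  have phiv : upd phi w W v = phi v.
    by rewrite /upd; case: eqP vU => // ->; rewrite (negPf wU).
  have vM : v \in U :\: cls U phi W by rewrite !inE vU (negPf vW).
  have := reach_stuck vM _ _ jB; rewrite phiv => /(_ (UA v vU) vB).
  rewrite cls_upd_new //; case: eqP => _; last by rewrite mul0n addn0.
  by rewrite mul1n => two; apply: leq_trans two (nbrsU1_le _ _ _).
case: (boolP [exists y in U,
    (phi y \notin B) && (nbrs y (cls U phi W) <= 1)]); last first.
  rewrite negb_exists => /forallP none.
  have confB : config S K B (part U phi B).
    apply: (subconfig sAK sUS cS fU) => // v j /notin_part[vS|[vU vB]] jB.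
      by apply: st => //; apply: subsetP jB.
    case: (eqVneq j W) => [->|jW]; first by have := none v; rewrite vU vB /= -ltnNge.
    by have := stB v j vU vB jB; rewrite (negPf jW) addn0.
  case: (sub_config_eq confB sBA) => // eB; by rewrite eB XA in Xacc.
case/existsP=> y /and3P[yU yB y1].
pose U' := part U phi B.
pose B1 := reach U' U' B phi (deficient U' phi).
have fU' : fits U' B phi by apply: fits_part fU.
have sB1B : B1 \subset B by apply: reach_sub.
case: (boolP (W \in B1)) => [WB1|WB1].
  have yU' : y \notin U' by rewrite inE yU.
  have [|psi fpsi] := insert_vertex fU' yU' WB1.
    by rewrite cls_part //; apply: forest_leaf y1 (fo W WA).
  apply: (@extend_by_smaller B U' [set v | e w v] y psi) => //.
  - by apply/card_gt0P; exists W.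
  - exact: subset_trans sAK.
  - exact: subset_trans (part_sub _ _ _) sUS.
  - exact: card_part_full fU _ full.
  - by rewrite inE yU' (subsetP sUS).
  - apply: leq_trans (Delta_max w setT).
    by apply/subset_leq_card/subsetP => v; rewrite !inE.
  - rewrite disjoint_sym -setI_eq0; apply/eqP.
    by move/cards0_eq: wF => <-; apply/setP => v; rewrite !inE.
  - move=> v vS; rewrite nbrs_part inE (bigD1 W WB) /= e_sym.
    have : \sum_(j in B | j != W) 2 <= \sum_(j in B | j != W) nbrs v (cls U phi j).
      apply: leq_sum => j /andP[jB jW].
      case: (notin_part vS) => [vU|[vU vB]].
        by apply: st => //; apply: subsetP jB.
      by have := stB v j vU vB jB; rewrite (negPf jW) addn0.
    have : 2 <= nbrs v (cls U phi W) + e v w.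
      case: (notin_part vS) => [vU|[vU vB]]; last first.
        by have := stB v W vU vB WB; rewrite eqxx mul1n.
      by apply: leq_trans (st v W vU WA) (leq_addr _ _).
    rewrite sum_nat_const (cardsD1 W B) WB (_ : #|_| = #|B :\ W|); last first.
      by apply: eq_card => i; rewrite in_setD1 andbC.
    move: (\sum_(_ in _ | _) _) #|_| (nbrs _ _) (nat_of_bool _); clear; lia.
have confB1 : config S K B1 (part U phi B1).
  apply: (subconfig sAK sUS cS fU); first exact: subset_trans sBA.
    move=> i /setDP[iA]; apply: contra => di.
    have iB : i \in B by apply: reach_target; rewrite ?di.
    by apply: reach_target => //; rewrite /deficient cls_part.
  move=> v j /notin_part[vS|[vU vB1]] jB1; have jB := subsetP sB1B j jB1.
    by apply: st => //; apply: subsetP jB.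
  have [vB|vB] := boolP (phi v \in B).
    have vU' : v \in U' by rewrite inE vU.
    by have := reach_stuck vU' vB vB1 jB1; rewrite cls_part.
  have jW : j != W by apply: contraNneq WB1 => <-.
  by have := stB v j vU vB jB; rewrite (negPf jW) addn0.
case: (sub_config_eq confB1 (subset_trans sB1B sBA)) => // eB1.
by rewrite eB1 WA in WB1.
Qed.

(** Induction on the number of vertices that have to leave [W]; [D] is a set of
    non-dense vertices meeting every cycle of [w |: W]. *)
Lemma enter_class n phi (D : {set T}) :
  #|D| < n -> fits U A phi -> D \subset cls U phi W ->
  (forall x, x \in D -> nbrs x U + 2 <= 2 * a) ->
  forest ((w |: cls U phi W) :\: D) -> solved.
Proof.
elim: n phi D => [|n IHn] phi D // Dn fU sDW degD fD.
have [sAK sUS cS _] := conf; have [UA fo le] := fU.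
have [D0|[x xD]] := set_0Vmem D.
  case: (full_reach fU) => [//|[full _]].
  have [||psi fpsi] := insert_vertex fU wU (i := W); first by rewrite full.
    by move: fD; rewrite D0 setD0.
  apply: (@extend_by_smaller A U set0 w psi) => //; first exact: config_pos.
  - by rewrite cards0.
  - by rewrite -setI_eq0 set0I.
  - by move=> v vS; rewrite inE addn0; apply: config_nbrs conf vS.
have sD' : D :\ x \subset D by apply: subD1set.
have D'n : #|D :\ x| < n by rewrite (cardsD1 x) xD in Dn.
have degD' y : y \in D :\ x -> nbrs y U + 2 <= 2 * a by move/(subsetP sD')/degD.
have := subsetP sDW x xD; rewrite inE => /andP[xU /eqP xW].
case: (posnP (nbrs x (cls U phi W))) => [x0|x_pos].
  apply: (IHn phi (D :\ x)) => //; first exact: subset_trans sDW.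
  exact: forest_restore_isolated (fo W WA) fD x0.
  (* x has at most 2a - 2 neighbours in U, one of which is in class W *)
  have /existsP[X /and3P[XA XW x1]] :
    [exists X in A, (X != W) && (nbrs x (cls U phi X) <= 1)].
  apply: contraT; rewrite negb_exists => /forallP none; have := degD x xD.
  rewrite -(sum_nbrs_cls x UA) (bigD1 W) //=.
  have : \sum_(i in A | i != W) 2 <= \sum_(i in A | i != W) nbrs x (cls U phi i).
    apply: leq_sum => i /andP[iA iW]; have := none i.
    by rewrite iA iW /= -ltnNge.
  rewrite sum_nat_const (_ : #|_| = a.-1); last first.
    rewrite (cardsD1 W A : a = _) WA; apply: eq_card => i.
    by rewrite !inE andbC.
  have := config_pos; rewrite -/a; move: a (\sum_(_ in _ | _) _) (nbrs _ _) x_pos.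
  by clear; lia.
case: (boolP (X \in accepting phi)) => [Xacc|Xacc]; last exact: solved_if_blocked Xacc.
have [chi [fchi sD'W fD']] := swap_out fU sDW fD xD XW x1 Xacc.
exact: IHn fchi sD'W degD' fD'.
Qed.

End Enter.
End Minimal.

Lemma solve_config A U : config S K A U -> exists chi, fits S K chi.
Proof.
move: {2}#|A|.+1 (ltnSn #|A|) => n; elim: n A U => // n IHn A U An conf.
have below A' U' : config S K A' U' -> #|A'| < #|A| -> exists chi, fits S K chi.
  by move=> conf' lt; apply: IHn conf'; apply: leq_trans lt _.
have /card_gt0P[W WA] := config_pos conf.
have [_ _ _ [phi [fU _]]] := conf.
have [w [wB wF w1]] := good_vertex conf fU WA.
pose D := (cls U phi W :&: [set v | e w v]) :\: dense A U.
apply: (enter_class conf below wB wF WA (ltnSn _) fU (D := D)).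
- exact: subset_trans (subsetDl _ _) (subsetIl _ _).
- move=> x /setDP[/setIP[]]; rewrite !inE => /andP[-> _] _ /=; lia.
have [_ fo _] := fU.
apply: (@forest_sub _ (w |: (cls U phi W :\: D))).
  by apply/subsetP => v; rewrite !inE; case: (v == w) => //=; rewrite andbC.
apply: forest_leaf; last exact: forest_sub (subsetDl _ _) (fo W WA).
apply: leq_trans w1; apply/subset_leq_card/subsetP => v; rewrite !inE.
by case: (v \in U) => //=; case: (phi v == W) => //=;
  case: (e w v); rewrite ?andbF // !andbT negbK.
Qed.

End Step.

(** * Counting colours *)

Lemma fits_vertexwise (i0 : C) S K :
  (forall S' A U, S' \subset S -> config S' K A U -> exists chi, fits S' K chi) ->
  exists chi, fits S K chi.
Proof.
move: {2}#|S|.+1 (ltnSn #|S|) => n; elim: n S => // n IHn S Sn solve.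
have [S0|[z zS]] := set_0Vmem S.
  have cls0 j : cls S (fun=> i0) j = set0 by apply/setP => v; rewrite S0 !inE.
  exists (fun=> i0); split=> [v|j _|j _]; first by rewrite S0 inE.
    by rewrite cls0; apply: forest0.
  by rewrite cls0 cards0.
have [||phi fphi] := IHn (S :\ z); first by rewrite (cardsD1 z) zS in Sn.
  by move=> S' A U sS'; apply: solve; apply: subset_trans sS' (subD1set _ _).
have cS : #|S :\: (S :\ z)| = (\sum_(i in K :\: K) c i).+1.
  by rewrite setDv big_set0 setDDr setDv set0U (setIidPr _) ?sub1set // cards1.
case: (augment_or_config (subxx K) (subD1set S z) cS fphi) => [|[conf _]]; last first.
  exact: solve conf.
case=> y; rewrite !inE negb_and negbK => /andP[+ yS].
by rewrite yS orbF => /eqP-> [chi]; rewrite setD1K // => fchi; exists chi.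
Qed.

Section Capacities.

Variables (Delta s : nat) (i0 : C).
Hypothesis Delta_max : forall v (X : {set T}), nbrs v X <= Delta.
Hypothesis c_bounds : forall i, s <= c i <= s.+1.

(** The inequality on [#|F|] reserves [Delta] new exceptional vertices for each
    colour given up. *)
Lemma fits_few_colours k0 S (F : {set T}) K :
  2 * k0 + (2 * Delta + 1) * (k0 * Delta) <= s ->
  #|K| <= k0 -> #|F| + #|K| * Delta <= k0 * Delta ->
  #|S| <= \sum_(i in K) c i ->
  (forall v, v \in S -> nbrs v S + 2 <= 2 * #|K| + (v \in F)) ->
  exists chi, fits S K chi.
Proof.
move=> s_large; move: {2}#|K|.+1 (ltnSn #|K|) => m.
elim: m S F K => // m IHm S F K Km Kk FK cS degS.
apply: fits_vertexwise => // S' A U sS'.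
apply: (@solve_config Delta s Delta_max c_bounds S' K F) => //.
- exact: leq_trans (subset_leq_card sS') cS.
- move=> v vS; apply: leq_trans (degS v (subsetP sS' v vS)).
  by rewrite leq_add2r nbrs_sub.
- have : #|F| <= k0 * Delta by apply: leq_trans FK; apply: leq_addr.
  move/(leq_mul (leqnn (2 * Delta + 1))) => F_le; lia.
move=> S'' F' K' K'K cS'' degS'' F'_le; apply: (IHm S'' F' K') => //.
- exact: leq_trans K'K _.
- by apply: leq_trans (ltnW K'K) Kk.
- have := leq_mul K'K (leqnn Delta); rewrite mulSn; lia.
Qed.

(** In an obstruction a vertex outside [U] shows [2 * #|A| <= Delta], and a class
    with room, having at most [s] vertices, shows that the other colours are at
    most half of [Delta] as well. *)
Lemma fits_many_colours S K : Delta < #|K| -> #|S| <= \sum_(i in K) c i ->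
  exists chi, fits S K chi.
Proof.
move=> DK cS; apply: fits_vertexwise => // S' A U sS' conf; exfalso.
have [sAK sUS' cS' [phi [[UA fo le] st]]] := conf.
have cK : #|K :\: A| + #|A| = #|K|.
  by rewrite -(cardsID A K) (setIidPr sAK) addnC.
have [W [WA dW]] : exists W, W \in A /\ #|cls U phi W| <= s.
  have /existsP[W /andP[WA dW]] : [exists W in A, #|cls U phi W| < c W].
    apply: contraT; rewrite negb_exists => /forallP none.
    have : \sum_(i in A) c i <= \sum_(i in A) #|cls U phi i|.
      by apply: leq_sum => i iA; have := none i; rewrite iA /= -leqNgt.
    rewrite (card_cls UA); have := leq_trans (subset_leq_card sS') cS.
    rewrite (big_setID A) (setIidPr sAK) /= -(cardsID U S') (setIidPr sUS') cS'.
    rewrite addnS => lt ge; have := leq_trans lt (leq_add ge (leqnn _)).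
    by rewrite ltnn.
  by exists W; split=> //; have /andP[_ cW] := c_bounds W; rewrite -ltnS (leq_trans dW).
have b_lo : #|K :\: A| * s < #|S' :\: U|.
  rewrite cS' ltnS -sum_nat_const; apply: leq_sum => i _.
  by case/andP: (c_bounds i).
have a_hi : 2 * #|A| <= Delta.
  have /card_gt0P[v vS] : 0 < #|S' :\: U| by rewrite cS'.
  exact: leq_trans (config_nbrs conf vS) (Delta_max _ _).
have : 2 * #|S' :\: U| <= s * Delta.
  apply: (@leq_trans (\sum_(v in S' :\: U) nbrs v (cls U phi W))).
    by rewrite mulnC -sum_nat_const; apply: leq_sum => v vS; apply: st.
  rewrite sum_nbrs_sym; apply: (@leq_trans (\sum_(v in cls U phi W) Delta)).
    by apply: leq_sum => v _; apply: Delta_max.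
  by rewrite sum_nat_const leq_mul2r dW orbT.
nia.
Qed.

End Capacities.
End Colouring.
End Graph.

(** * Equitable colourings *)

Lemma sum_lt_ord r k : r <= k -> \sum_(i < k) (i < r) = r.
Proof.
move=> rk; rewrite -[RHS](minn_idPl rk) => {rk}.
elim: k => [|k IHk]; first by rewrite big_ord0 minn0.
by rewrite big_ord_recr /= IHk; lia.
Qed.

Lemma is_forest_induced (T : finType) (e : rel T) (A : {set T}) :
  forest e A -> is_forest (induced e A).
Proof.
move=> fA p p3 /andP[pc pu]; apply: (fA (map val p)); first by rewrite size_map.
  by rewrite /ucycle cycle_map pc map_inj_uniq //; apply: val_inj.
by move=> _ /mapP[x _ ->]; apply: valP.
Qed.

Theorem theorem1p4 (Delta k n : nat)
  (hDelta : 0 < Delta) (hk : 0 < k) (hn : 0 < n)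
  (hkDelta : Delta + 2 <= 2 * k) (hnDelta : 3 * Delta ^ 4 <= n)
  (T : finType) (e : rel T)
  (e_sym : symmetric e) (e_irr : irreflexive e)
  (hT : #|T| = n) (hdeg : max_degree e <= Delta) :
  exists phi : {ffun T -> 'I_k}, equitable_tree_colouring e phi.
Proof.
have Delta_max (v : T) (X : {set T}) : nbrs e v X <= Delta.
  apply: leq_trans hdeg; apply: leq_trans (leq_bigmax v).
  by apply/subset_leq_card/subsetP => y; rewrite !inE => /andP[].
pose c (i : 'I_k) := n %/ k + (i < n %% k).
have c_bounds i : n %/ k <= c i <= (n %/ k).+1.
  by rewrite /c leq_addr -[X in _ && (_ <= X)]addn1 leq_add2l leq_b1.
have c_sum : \sum_(i in [set: 'I_k]) c i = n.
  rewrite (eq_bigl xpredT) => [|i]; last by rewrite inE.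
  rewrite big_split sum_nat_const card_ord /= sum_lt_ord; last first.
    exact: ltnW (ltn_pmod _ _).
  by rewrite mulnC -divn_eq.
have cardK : #|[set: 'I_k]| = k by rewrite cardsT card_ord.
have [phi [_ fo le]] : exists phi, fits e c [set: T] [set: 'I_k] phi.
  case: (ltnP Delta k) => [Dk|kD].
    by apply: (fits_many_colours e_sym e_irr (Ordinal hk) Delta_max c_bounds);
      rewrite ?cardK // c_sum cardsT hT.
  have s_big : 3 * Delta ^ 3 <= n %/ k.
    rewrite leq_divRL //; apply: leq_trans hnDelta.
    by rewrite -mulnA (expnSr _ 3) leq_mul2l leq_mul2l kD orbT.
  have F0 : #|set0 : {set T}| = 0 by apply: cards0.
  apply: (fits_few_colours e_sym e_irr (Ordinal hk) Delta_max c_bounds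
    (k0 := k) (F := set0)); rewrite ?cardK ?F0 ?c_sum ?cardsT ?hT //.
  - apply: leq_trans s_big; have D2 : 2 <= Delta by lia.
    have := leq_mul kD (leqnn ((2 * Delta + 1) * Delta)).
    have := leq_mul D2 (leqnn (Delta * Delta)).
    have := leq_mul D2 (leqnn Delta).
    rewrite !expnS expn0 muln1; nia.
  - move=> v _; rewrite inE addn0; apply: leq_trans hkDelta.
    by rewrite leq_add2r.
have cardE i : #|cls [set: T] phi i| = c i.
  apply/eqP; rewrite eqn_leq le ?inE //=.
  have : \sum_(j in [set: 'I_k]) #|cls [set: T] phi j| = \sum_(j in [set: 'I_k]) c j.
    by rewrite card_cls ?c_sum ?cardsT ?hT // => v _; rewrite inE.
  rewrite (bigD1 i) ?inE //= [X in _ = X](bigD1 i) ?inE //=.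
  have : \sum_(j in [set: 'I_k] | j != i) #|cls [set: T] phi j| <=
      \sum_(j in [set: 'I_k] | j != i) c j.
    by apply: leq_sum => j _; apply: le; rewrite inE.
  by move: #|_| (c i) (\sum_(_ in _ | _) _) (\sum_(_ in _ | _) _); clear; lia.
have classE i : colour_class [ffun v => phi v] i = cls [set: T] phi i.
  by apply/setP => v; rewrite !inE ffunE.
exists [ffun v => phi v]; split=> [i j|i].
  rewrite !classE !cardE; have /andP[_ ci] := c_bounds i.
  have /andP[cj _] := c_bounds j.
  by apply: leq_trans ci _; rewrite addn1 ltnS.
by apply: is_forest_induced; rewrite classE; apply: fo; rewrite inE.
Qed.
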